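(* Let $C$ be any cycle (of any length $\ge 3$) whose edges are each colored red or blue. Then $\mathrm{mex}(2,C)\le 1/2$.
   Context: Given graphs $R$ (red) and $B$ (blue) on a common $n$-vertex set, $R\sqcup B$ denotes the $2$-edge-colored multigraph whose red edges are $E(R)$ and blue edges are $E(B)$. It contains a copy of a red/blue-colored graph $H$ if there is an injective map $\phi:V(H)\to V$ such that every red edge $xy$ of $H$ has $\phi(x)\phi(y)\in E(R)$ and every blue edge has $\phi(x)\phi(y)\in E(B)$. $\mathrm{mex}(2,n,H)$ is the largest integer $T$ such that there are such $R,B$ with $|E(R)|,|E(B)|\ge T$ and $R\sqcup B$ containing no copy of $H$, and $\mathrm{mex}(2,H)=\lim_{n\to\infty}\mathrm{mex}(2,n,H)/\binom n2$. *)

(* Defs.v *)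
From mathcomp Require Import all_boot all_order all_algebra.
From mathcomp Require Import all_classical all_reals all_analysis.

Set Implicit Arguments.
Unset Strict Implicit.
Unset Printing Implicit Defensive.

Import Order.TTheory GRing.Theory Num.Theory.
Import numFieldNormedType.Exports.

Local Open Scope ring_scope.

(* A simple graph on V is given by its set of edges: two-element subsets of V,
   the edge xy being [set x; y]. *)
Definition simple_graph (V : finType) (E : {set {set V}}) : bool :=
  [forall e in E, #|e| == 2].

(* Colour of an edge: true is red, false is blue; the values of is_red outside
   edges are irrelevant. *)
Record colored_graph := ColoredGraph {
  vertices : finType;
  edges : {set {set vertices}};
  edges_simple : simple_graph edges;
  is_red : {set vertices} -> bool }.

Definition contains_copy (H : colored_graph) (V : finType)
    (R B : {set {set V}}) : bool :=
  [exists phi : {ffun vertices H -> V},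
    injectiveb phi &&
    [forall x, forall y, ([set x; y] \in edges H) ==>
      (if is_red [set x; y] then [set phi x; phi y] \in R
       else [set phi x; phi y] \in B)]].

(* R and B may share edges. *)
Definition achievable (n : nat) (H : colored_graph) (T : nat) : bool :=
  [exists R : {set {set 'I_n}}, exists B : {set {set 'I_n}},
    [&& simple_graph R, simple_graph B,
        (T <= #|R|)%N, (T <= #|B|)%N & ~~ contains_copy H R B]].

(* A simple graph on 'I_n has at most 'C(n, 2) edges, so the bound on T is
   harmless. The empty graphs make T = 0 achievable as soon as H has an edge;
   the default value 0 of \max thus plays no role for cycles. *)
Definition mex2n (n : nat) (H : colored_graph) : nat :=
  \max_(T < ('C(n, 2)).+1 | achievable n H T) T.

Definition mex2_density (R : realType) (H : colored_graph) (n : nat) : R :=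
  (mex2n n H)%:R / 'C(n, 2)%:R.

Definition mex2 (R : realType) (H : colored_graph) : R :=
  limn (mex2_density R H).

(* ordS i is i + 1 modulo k. *)
Definition cycle_edges (k : nat) : {set {set 'I_k}} :=
  [set [set i; ordS i] | i : 'I_k].

Lemma cycle_edges_simple (k : nat) : (3 <= k)%N -> simple_graph (cycle_edges k).
Proof.
move=> k3; apply/forall_inP => _ /imsetP[i _ ->]; rewrite cards2 eqSS eqb1.
apply/negP => /eqP /(congr1 val) /=; case: (ltngtP i.+1 k) (ltn_ord i) => //.
- by move=> lt _; rewrite modn_small // => /n_Sn.
- by move=> e _; rewrite e modnn => i0; move: k3; rewrite -e i0.
Qed.

Definition colored_cycle (k : nat) (k_ge3 : (3 <= k)%N)
    (c : {set 'I_k} -> bool) : colored_graph :=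
  ColoredGraph (cycle_edges_simple k_ge3) c.

(* Main.v *)
Require Import Defs.
From mathcomp Require Import all_boot all_order all_algebra.
From mathcomp Require Import all_classical all_reals all_analysis.
From mathcomp Require Import perm zify ring lra.

Set Implicit Arguments.
Unset Strict Implicit.
Unset Printing Implicit Defensive.

Import Order.TTheory GRing.Theory Num.Theory.
Import numFieldNormedType.Exports.

Local Open Scope ring_scope.

(* Convergence: a suitable m-vertex sample of a large pair (R, B)
   has nearly the same density as the original in both colours. The sample is
   built greedily, one vertex at a time, keeping small a potential that controls
   the squared deviation of both edge counts.

   Upper bound: let |R| + |B| > (1 + eps) 'C(n, 2). A vertex set S maximising
   e(S) - (1/2 + eps/4) |S|^2 is large and has minimum degree (red plus blue)
   at least (1 + eps/4)|S|, so the graph G of doubly coloured edges has positive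
   minimum degree in S and contains a biclique with parts f, h of any fixed
   size t. It contains every even cycle. By averaging, some vertex w outside
   has total multiplicity at least 3 to some pair (f i, h i): one of wf, wh is
   doubly coloured and the other has some colour. Hence every odd cycle using
   both colours embeds, the edge of prescribed colour being placed on the
   possibly singly coloured one. For a monochromatic cycle take R = B. *)

(** * Dense cores and bicliques *)

Lemma loop_notin (V : finType) (E : {set {set V}}) (v : V) :
  simple_graph E -> ([set v; v] \in E) = false.
Proof.
move=> /forall_inP sE; apply/negP => /sE.
by rewrite finset.setUid cards1.
Qed.

Lemma card_pairs_set2 (V : finType) (e : {set V}) :
  #|e| == 2 -> #|[set p : V * V | [set p.1; p.2] == e]| = 2%N.
Proof.
move=> /cards2P [a [b [ab ->]]].
have -> : [set p : V * V | [set p.1; p.2] == [set a; b]] = [set (a, b); (b, a)].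
  apply/setP => -[x y]; rewrite !inE /= !xpair_eqE; apply/eqP/idP.
    move=> xyab.
    have ax : a \in [set x; y] by rewrite xyab set21.
    have bx : b \in [set x; y] by rewrite xyab set22.
    have /set2P xab : x \in [set a; b] by rewrite -xyab set21.
    move: ax bx; rewrite !inE; case: xab => ->; rewrite !eqxx /=.
      by rewrite (eq_sym b a) (negbTE ab) /= => _ /eqP ->; rewrite eqxx.
    by rewrite (negbTE ab) (eq_sym b a) (negbTE ab) /= => /eqP ->; rewrite eqxx.
  by case/orP => /andP[/eqP -> /eqP ->] //; rewrite finset.setUC.
by rewrite cards2 xpair_eqE negb_and ab.
Qed.

(** Double counting of ordered pairs against edges: each edge has exactly two orderings. *)
Lemma sum_adj (V : finType) (E : {set {set V}}) : simple_graph E ->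
  (\sum_(u : V) \sum_(v : V) ([set u; v] \in E) = 2 * #|E|)%N.
Proof.
move=> /forall_inP sE; rewrite pair_big /=.
rewrite (eq_bigr (fun p : V * V => \sum_(e in E | [set p.1; p.2] == e) 1)%N); last first.
  move=> p _; rewrite sum1_card; case: (boolP ([set p.1; p.2] \in E)) => pE //=.
    rewrite -[LHS](cards1 [set p.1; p.2]); apply: eq_card => e.
    by rewrite inE [RHS]unfold_in andbC (eq_sym e); case: eqVneq => //= <-; rewrite pE.
  apply/esym/eq_card0 => e; rewrite [LHS]unfold_in andbC.
  by case: eqVneq => // <-; rewrite (negbTE pE).
rewrite (exchange_big_dep (mem E)) //=; last by move=> ? ? _ /andP[].
rewrite mulnC -sum_nat_const; apply: eq_bigr => e eE.
rewrite -(card_pairs_set2 (sE _ eE)) -sum1_card.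
by apply: eq_bigl => p; rewrite !inE eE.
Qed.

(* Maximising [e(S) - a |S|^2] over all vertex sets cleans up low degrees. *)
Lemma dense_core (R : realFieldType) (V : finType) (w : V -> V -> nat) (a : R) :
  (forall u v, w u v = w v u) -> (forall v, w v v = 0%N) ->
  exists S : {set V},
    (\sum_u \sum_v w u v)%N%:R - a * #|V|%:R ^+ 2 <=
      (\sum_(u in S) \sum_(v in S) w u v)%N%:R - a * #|S|%:R ^+ 2 /\
    forall v, v \in S -> a * (2 * #|S|%:R - 1) <= 2 * (\sum_(u in S) w v u)%N%:R.
Proof.
move=> wC w0.
pose Phi (S : {set V}) : R := (\sum_(u in S) \sum_(v in S) w u v)%N%:R - a * #|S|%:R ^+ 2.
have [S _ maxS] := @Order.TotalTheory.arg_maxP _ _ {set V} finset.setT xpredT Phi isT.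
exists S; split.
  have sumT (F : V -> nat) : (\sum_(u in finset.setT) F u = \sum_u F u)%N.
    by apply: eq_bigl => u; rewrite !inE.
  have := maxS finset.setT isT; rewrite /Phi cardsT sumT.
  by rewrite (eq_bigr _ (fun u _ => sumT (w u))).
move=> v vS.
have -> : (\sum_(u in S) w v u = \sum_(u in S :\ v) w v u)%N.
  by rewrite (big_setD1 v vS) /= w0.
(* Deleting [v] takes twice its degree off the ordered sum and [a * (2 * #|S| - 1)] off the
   quadratic term; by maximality of [S] the net effect is no gain. *)
have := maxS (S :\ v) isT; rewrite /Phi.
rewrite (big_setD1 v vS) /= [in X in _ <= X - _](big_setD1 v vS) /= w0 add0n.
rewrite [X in _ <= (_ + X)%N%:R - _](eq_bigr
  (fun u => w v u + \sum_(x in S :\ v) w u x)%N); last first.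
  by move=> u uS; rewrite (big_setD1 v vS) /= wC.
rewrite big_split /= [#|S|](cardsD1 v) vS add1n -natr1 !natrD.
set x := (\sum_(i in _) w v i)%N%:R; set y := (\sum_(i in _) \sum_(j in _) _)%N%:R.
set s : R := #|_|%:R.
lra.
Qed.

Lemma expn_le_ffact (g t : nat) : ((g - t) ^ t <= g ^_ t)%N.
Proof.
suff H m : (m <= t)%N -> ((g - t) ^ m <= g ^_ m)%N by exact: H.
elim: m => [|m IH] mt; first by rewrite ffactn0.
by rewrite ffactnSr expnSr leq_mul ?IH ?leq_sub2l // ltnW.
Qed.

(* Kovari-Sos-Turan, counting injections [f] into common neighbourhoods. *)
Lemma complete_bipartite (R : realFieldType) (V : finType) (G : rel V)
    (S : {set V}) (t : nat) (d : R) : 0 < d ->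
  (forall v, v \in S -> d * #|S|%:R <= #|[set u in S | G v u]|%:R) ->
  2 * t%:R <= d * #|S|%:R -> t%:R < #|S|%:R * (d / 2) ^+ t ->
  exists f h : 'I_t -> V, [/\ injective f, injective h,
    forall i, f i \in S, forall i, h i \in S & forall i j, G (h j) (f i)].
Proof.
move=> d0 degG st ts.
pose common (f : {ffun 'I_t -> V}) := [set v in S | [forall i, G v (f i)]].
have [[f injf /andP[fS tf]]|nof] := @exists_inP _ (fun f : {ffun 'I_t -> V} => injectiveb f)
   (fun f => [forall i, f i \in S] && (t <= #|common f|)%N).
  have cS i : (i < t)%N -> (i < size (enum (common f)))%N.
    by rewrite -cardE => /leq_trans -> .
  case: (posnP t) => [t0|t0].
    by exists f, f; split=> i; have := ltn_ord i; rewrite [X in (_ < X)%N]t0.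
  have v0 : V := f (Ordinal t0).
  exists f, (fun i : 'I_t => nth v0 (enum (common f)) i).
  have memc (i : 'I_t) : nth v0 (enum (common f)) i \in common f.
    by rewrite -mem_enum mem_nth // cS.
  split.
  - exact/injectiveP.
  - move=> i j /eqP; rewrite nth_uniq ?enum_uniq ?cS // => /eqP ?; exact: val_inj.
  - exact/forallP.
  - by move=> i; have := memc i; rewrite inE => /andP[].
  - by move=> i j; have := memc j; rewrite inE => /andP[_ /forallP].
exfalso.
(* Count pairs of a vertex [v] in [S] and an injection into its neighbourhood in [S]. As
   [2 * t <= d * #|S|], at least half of the guaranteed degree remains after subtracting [t]. *)
have lb : #|S|%:R * (d / 2 * #|S|%:R) ^+ t <=
    (\sum_(v in S) #|[set u in S | G v u]| ^_ t)%N%:R :> R.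
  rewrite natr_sum -[X in X%:R * _]sum1_card natr_sum mulr_suml; apply: ler_sum => v vS.
  rewrite mul1r; apply: (@le_trans _ _ ((#|[set u in S | G v u]| - t) ^ t)%N%:R); last first.
    by rewrite ler_nat expn_le_ffact.
  have gS := degG v vS; set g := #|[set _ in _ | _]| in gS *.
  have tg : (t <= g)%N by rewrite -(ler_nat R); have := ler0n R t; lra.
  have le_g : d / 2 * #|S|%:R <= (g - t)%N%:R :> R by rewrite natrB //; lra.
  rewrite natrX; apply: lerXn2r => //; rewrite nnegrE ?ler0n //.
  by rewrite mulr_ge0 ?ler0n ?divr_ge0 ?(ltW d0).
(* Count the same pairs by injections: by [nof] each has fewer than [t] common neighbours, and there
   are at most [#|S| ^ t] of them. Cancelling this power in [lb] contradicts [ts]. *)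
have ub : (\sum_(v in S) #|[set u in S | G v u]| ^_ t <= t * #|S| ^ t)%N.
  rewrite (eq_bigr (fun v => \sum_(f : {ffun 'I_t -> V} |
      [&& injectiveb f, [forall i, f i \in S] & [forall i, G v (f i)]]) 1)%N); last first.
    move=> v _; rewrite -[in LHS](card_ord t) -card_inj_ffuns_on sum1dep_card.
    apply: eq_card => f; rewrite !inE andbC; congr (_ && _).
    apply/ffun_onP/andP => [H|[/forallP H1 /forallP H2] i].
      by split; apply/forallP => i; have := H i; rewrite inE => /andP[].
    by rewrite inE H1 H2.
  rewrite (exchange_big_dep (fun f : {ffun 'I_t -> V} =>
      injectiveb f && [forall i, f i \in S])) /=; last first.
    by move=> v f _ /and3P[-> ->].
  apply: (@leq_trans (\sum_(f : {ffun 'I_t -> V} | f \in ffun_on (mem S)) t)%N); last first.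
    by rewrite sum_nat_const card_ffun_on card_ord mulnC.
  rewrite [leqRHS](bigID (fun f : {ffun 'I_t -> V} => injectiveb f)) /=.
  apply: leq_trans (leq_addr _ _).
  rewrite [leqRHS](eq_bigl (fun f : {ffun 'I_t -> V} =>
      injectiveb f && [forall i, f i \in S])); last first.
    by move=> f; rewrite andbC; congr (_ && _); apply/ffun_onP/forallP.
  apply: leq_sum => f /andP[injf fS].
  rewrite leqNgt; apply/negP => lt; apply: nof; exists f => //.
  rewrite fS /=; apply: leq_trans (ltnW lt) _; rewrite sum1dep_card.
  apply: subset_leq_card; apply/fintype.subsetP => v; rewrite !inE.
  by case/andP => -> /and3P[_ _ ->].
have := le_trans lb; rewrite -(ler_nat R) in ub => /(_ _ ub).
rewrite natrM natrX exprMn mulrA.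
have s0 : 0 < #|S|%:R :> R.
  by move: ts; case: #|S| => // ; rewrite mul0r ltNge ler0n.
by rewrite ler_pM2r ?exprn_gt0 // leNgt ts.
Qed.

(** * Cycles inside a biclique *)

(** All edges of the path [psi] meet every constraint [E x]; only the closing edge must be matched
    with an index, and rotating the path puts it at [j]. *)
Lemma closed_walk_rotate (k : nat) (V : finType) (E : 'I_k -> {set {set V}})
    (psi : nat -> V) (j : 'I_k) :
  {in [pred a | (a < k)%N] &, injective psi} ->
  (forall x a, (a.+1 < k)%N -> [set psi a; psi a.+1] \in E x) ->
  [set psi k.-1; psi 0%N] \in E j ->
  exists phi : 'I_k -> V,
    injective phi /\ forall x, [set phi x; phi (ordS x)] \in E x.
Proof.
move=> psi_inj psiS psi_j.
have k0 : (0 < k)%N := leq_ltn_trans (leq0n _) (ltn_ord j).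
(* This shift sends [j] to [k - 1], the index of the closing edge. *)
pose rho (x : 'I_k) := ((x + (k - j.+1)) %% k)%N.
have rho_inj : injective rho.
  move=> x y /eqP; rewrite eqn_modDr !modn_small ?ltn_ord // => /eqP.
  exact: val_inj.
have rho_j : rho j = k.-1.
  rewrite /rho; have -> : (j + (k - j.+1) = k.-1)%N by have := ltn_ord j; lia.
  by rewrite modn_small // ltn_predL.
have rhoS x : rho (ordS x) = ((rho x).+1 %% k)%N.
  by rewrite /rho /= modnDml -[in RHS]addn1 modnDml addn1 addSn.
exists (psi \o rho); split=> [x y /psi_inj eq_xy|x].
  by apply: rho_inj; apply: eq_xy; rewrite inE ltn_mod.
rewrite /= rhoS; have: (rho x < k)%N by rewrite ltn_mod.
rewrite -(prednK k0) ltnS leq_eqVlt => /orP[/eqP xj|lt].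
  have -> : x = j by apply: rho_inj; rewrite xj rho_j.
  by rewrite rho_j prednK // modnn.
rewrite (prednK k0) modn_small; last by rewrite -(prednK k0) ltnS.
by apply: psiS; rewrite -(prednK k0) ltnS.
Qed.

(** Alternate between [f] and [h]: by parity the closing edge also joins the two sides. It meets
    every constraint, so any index, here [ord0], can be assigned to it. *)
Lemma even_cycle_in_biclique (k : nat) (V : finType) (E : 'I_k -> {set {set V}})
    (f h : 'I_k -> V) :
  (0 < k)%N -> ~~ odd k -> injective f -> injective h ->
  (forall i j, f i != h j) ->
  (forall x i j, [set f i; h j] \in E x) ->
  exists phi : 'I_k -> V,
    injective phi /\ forall x, [set phi x; phi (ordS x)] \in E x.
Proof.
case: k E f h => // k E f h _ /= /negPn k_odd f_inj h_inj fh fhE.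
pose psi (a : nat) : V := if odd a then h (inord a) else f (inord a).
apply: (@closed_walk_rotate _ _ E psi ord0).
- move=> a b; rewrite !inE => ak bk; rewrite /psi.
  have val_eq (u : 'I_k.+1 -> V) : injective u ->
      u (inord a) = u (inord b) -> a = b.
    by move=> u_inj /u_inj /(congr1 val) /=; rewrite !inordK.
  case: ifP => _; case: ifP => _; try exact: val_eq.
  + by move/esym/eqP; rewrite (negbTE (fh _ _)).
  + by move/eqP; rewrite (negbTE (fh _ _)).
- move=> x a _; rewrite /psi /=; case: (odd a) => //=.
  by rewrite finset.setUC.
- by rewrite /psi /= k_odd finset.setUC.
Qed.

(* The walk is [w, f 0, h 0, f 1, ..., f m, h m, w], with [f] and [h] reindexed
   so that its second vertex is [f i] and its last but one is [h i]. *)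
Lemma odd_cycle_in_biclique (m : nat) (V : finType)
    (E : 'I_(m.*2.+3) -> {set {set V}}) (f h : 'I_m.+1 -> V) (w : V)
    (i : 'I_m.+1) (j : 'I_m.*2.+3) :
  injective f -> injective h -> (forall i j, f i != h j) ->
  (forall i, f i != w) -> (forall i, h i != w) ->
  (forall x i j, [set f i; h j] \in E x) ->
  (forall x, [set w; f i] \in E x) -> [set h i; w] \in E j ->
  exists phi : 'I_(m.*2.+3) -> V,
    injective phi /\ forall x, [set phi x; phi (ordS x)] \in E x.
Proof.
move=> f_inj h_inj fh fw hw fhE wfE hwE.
pose psi (a : nat) : V :=
  if a is a'.+1 then
    if odd a' then h (tperm ord_max i (inord a'./2))
    else f (tperm ord0 i (inord a'./2))
  else w.
have half_lt a : (a < m.*2.+2)%N -> (a./2 < m.+1)%N by rewrite -doubleS ltn_half_double.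
apply: (@closed_walk_rotate _ _ E psi j).
- move=> [|a] [|b]; rewrite !inE //= ?ltnS => ak bk.
  + by case: ifP => _ /esym/eqP; rewrite ?(negbTE (fw _)) ?(negbTE (hw _)).
  + by case: ifP => _ /eqP; rewrite ?(negbTE (fw _)) ?(negbTE (hw _)).
  have val_eq (s : {perm 'I_m.+1}) (u : 'I_m.+1 -> V) : injective u ->
      u (s (inord a./2)) = u (s (inord b./2)) -> a./2 = b./2.
    move=> u_inj /u_inj /perm_inj /(congr1 val) /=.
    by rewrite !inordK ?half_lt.
  case: ifP => oa; case: ifP => ob.
  + move=> /(val_eq _ _ h_inj) eab.
    by rewrite -(odd_double_half a) -(odd_double_half b) oa ob eab.
  + by move/esym/eqP; rewrite (negbTE (fh _ _)).
  + by move/eqP; rewrite (negbTE (fh _ _)).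
  + move=> /(val_eq _ _ f_inj) eab.
    by rewrite -(odd_double_half a) -(odd_double_half b) oa ob eab.
- move=> x [_|a _] /=; first by rewrite (_ : inord 0 = ord0) ?tpermL //; apply/val_inj/inordK.
  by case: (odd a) => //=; rewrite finset.setUC.
- rewrite /= odd_double /= uphalf_double (_ : inord m = ord_max) ?tpermL //.
  exact/val_inj/inordK.
Qed.

(** * Embedding cycles in dense pairs *)

Lemma natr_bin2 (R : realFieldType) (n : nat) :
  2 * 'C(n, 2)%:R = n%:R * (n%:R - 1) :> R.
Proof.
have := mul_bin_diag n 1; rewrite bin1 => /(congr1 (fun x => x%:R : R)).
case: n => [|n]; first by rewrite bin0n !mulr0 mul0r.
by rewrite !natrM /= -[n.+1%:R]natr1 => <-; ring.
Qed.

Definition multiplicity (V : finType) (E1 E2 : {set {set V}}) (u v : V) : nat :=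
  (([set u; v] \in E1) + ([set u; v] \in E2))%N.

Lemma multiplicity_le2 (V : finType) (E1 E2 : {set {set V}}) (u v : V) :
  (multiplicity E1 E2 u v <= 2)%N.
Proof. by rewrite /multiplicity; do 2!case: (_ \in _). Qed.

(** With [a = 1 + eps / 2], the functional of [dense_core] is at least [eps / 4 * #|V| ^ 2] on the
    whole vertex set, where [8 <= eps * #|V|] absorbs the linear terms. On [S] it is at most
    [#|S| ^ 2], since multiplicities are at most 2. *)
Lemma large_core (R : realFieldType) (eps : R) (V : finType) (E1 E2 : {set {set V}}) :
  0 < eps -> eps <= 1 -> simple_graph E1 -> simple_graph E2 ->
  8 <= eps * #|V|%:R ->
  (1 + eps) * 'C(#|V|, 2)%:R <= #|E1|%:R + #|E2|%:R ->
  exists S : {set V}, eps / 4 * #|V|%:R <= #|S|%:R /\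
    forall v, v \in S -> (1 + eps / 2) * (2 * #|S|%:R - 1) <=
      2 * (\sum_(u in S) multiplicity E1 E2 v u)%N%:R.
Proof.
move=> e0 e1 sE1 sE2 nV dens.
have [||S [PhiS degS]] := @dense_core R V (multiplicity E1 E2) (1 + eps / 2).
- by move=> u v; rewrite /multiplicity finset.setUC.
- by move=> v; rewrite /multiplicity !loop_notin.
exists S; split=> //.
have sumV : (\sum_u \sum_v multiplicity E1 E2 u v = 2 * (#|E1| + #|E2|))%N.
  rewrite mulnDr -!sum_adj // -big_split; apply: eq_bigr => u _.
  by rewrite -big_split.
have sumS : (\sum_(u in S) \sum_(v in S) multiplicity E1 E2 u v <= 2 * (#|S| * #|S|))%N.
  rewrite mulnC -mulnA -sum_nat_const leq_sum // => u _.
  by rewrite -sum_nat_const leq_sum // => v _; exact: multiplicity_le2.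
have binV := natr_bin2 R #|V|.
move: PhiS; rewrite sumV natrM natrD.
rewrite -(ler_nat R) !natrM in sumS.
set n : R := #|V|%:R in nV binV *; set s : R := #|S|%:R in sumS *.
have : n * 8 <= n * (eps * n) by rewrite ler_wpM2l.
move=> n8 PhiS; rewrite -(@ler_pXn2r _ 2) // ?nnegrE ?mulr_ge0 ?divr_ge0 ?(ltW e0) //.
have n1 : eps * n <= 1 * n by rewrite ler_wpM2r.
have en : eps * (eps * n ^+ 2) <= 1 * (eps * n ^+ 2).
  by rewrite ler_wpM2r // mulr_ge0 ?(ltW e0) ?sqr_ge0.
have e_s : 0 <= eps * s ^+ 2 by rewrite mulr_ge0 ?(ltW e0) ?sqr_ge0.
have dens2 : (1 + eps) * (n * (n - 1)) <= 2 * (#|E1|%:R + #|E2|%:R).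
  by rewrite -binV; move: dens; lra.
lra.
Qed.

(* Averaging over [w] gives a vertex joined with total multiplicity at least 3
   to a pair [f i], [h i] of adjacent vertices of the biclique. *)
Lemma biclique_with_apex (R : realType) (eps : R) (t : nat) :
  0 < eps -> eps <= 1 -> (0 < t)%N ->
  exists N : nat, forall (V : finType) (E1 E2 : {set {set V}}),
    simple_graph E1 -> simple_graph E2 -> (N <= #|V|)%N ->
    (1 + eps) * 'C(#|V|, 2)%:R <= #|E1|%:R + #|E2|%:R ->
    exists f h : 'I_t -> V, exists w : V, exists i : 'I_t,
      [/\ injective f /\ injective h,
          (forall i j, [set f i; h j] \in E1 /\ [set f i; h j] \in E2),
          (forall i, f i != w) /\ (forall i, h i != w) &
          (2 < multiplicity E1 E2 (f i) w + multiplicity E1 E2 (h i) w)%N].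
Proof.
move=> e0 e1 t0.
pose d := eps / 4.
have d0 : 0 < d by rewrite divr_gt0.
have d2t : 0 < (d / 2) ^+ t by rewrite exprn_gt0 ?divr_gt0.
(* The summands of [C] serve [ds], [ts] and [es] below. In the bound on [#|V|], [C / d] forces
   [#|S| > C] and [8 / eps] meets the hypothesis of [large_core]. *)
pose C : R := 4 * t%:R / d + t%:R / (d / 2) ^+ t + 1 + 2 / eps.
have C1 : 0 <= 4 * t%:R / d by rewrite divr_ge0 ?mulr_ge0 ?ler0n // ltW.
have C2 : 0 <= t%:R / (d / 2) ^+ t by rewrite divr_ge0 ?ler0n // ltW.
have C3 : 0 <= 2 / eps by rewrite divr_ge0 // ltW.
have C0 : 0 <= C / d + 8 / eps.
  by rewrite addr_ge0 ?divr_ge0 ?(ltW e0) ?(ltW d0) // /C; lra.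
exists (Num.bound (C / d + 8 / eps)) => V E1 E2 sE1 sE2 NV dens.
have {NV} nV : C / d + 8 / eps < #|V|%:R.
  by apply: lt_le_trans (archi_boundP C0) _; rewrite ler_nat.
have nV8 : 8 <= eps * #|V|%:R.
  rewrite mulrC -ler_pdivrMr // ltW //; apply: le_lt_trans nV.
  by rewrite lerDr divr_ge0 ?(ltW d0) // /C; lra.
have [S [VS degS]] := large_core e0 e1 sE1 sE2 nV8 dens.
have SC : C < #|S|%:R.
  apply: lt_le_trans VS; rewrite mulrC -ltr_pdivrMr //; apply: le_lt_trans nV.
  by rewrite lerDl divr_ge0 // ltW.
set s : R := #|S|%:R in degS SC.
have ds : 4 * t%:R < d * s.
  by rewrite (mulrC d) -ltr_pdivrMr //; apply: le_lt_trans SC; rewrite /C; lra.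
have ts : t%:R < s * (d / 2) ^+ t.
  by rewrite -ltr_pdivrMr //; apply: le_lt_trans SC; rewrite /C; lra.
have es : 2 + eps <= eps * s.
  rewrite (mulrC eps) -ler_pdivrMr // mulrDl divff ?gt_eqF //; apply/ltW.
  by apply: le_lt_trans SC; rewrite /C; lra.
(* Half of the excess [eps / 2 * s] is given up to absorb the [- 1] of [degS]; [es] says exactly
   that this suffices. *)
have {}degS v : v \in S ->
    (1 + d) * s <= (\sum_(u in S) multiplicity E1 E2 v u)%N%:R.
  by move=> /degS; rewrite /d; lra.
pose G v u := ([set u; v] \in E1) && ([set u; v] \in E2).
have [||||f [h [f_inj h_inj fS hS fhG]]] := @complete_bipartite R V G S t d.
- by [].
- move=> v vS; have := degS v vS.
  (* One colour per vertex accounts for at most [#|S|]; the excess counts doubly coloured edges, so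
     [G] has minimum degree at least [d * s]. *)
  have : (\sum_(u in S) multiplicity E1 E2 v u <= #|S| + #|[set u in S | G v u]|)%N.
    apply: (@leq_trans (\sum_(u in S) (1 + G v u))%N).
      apply: leq_sum => u _; rewrite /multiplicity /G finset.setUC.
      by do 2!case: (_ \in _).
    rewrite big_split /= sum1_card leq_add2l -[leqRHS]sum1_card.
    rewrite [leqRHS](eq_bigl (fun u => (u \in S) && G v u)) => [|u]; last by rewrite inE.
    by rewrite big_mkcondr; apply: leq_sum => u _; case: (G v u).
  rewrite -(ler_nat R) natrD -/s; lra.
- have := ler0n R t; lra.
- by [].
have fh i j : f i != h j.
  apply/eqP => fhij; have := fhG i j; rewrite /G fhij.
  by rewrite loop_notin.
pose P : {set V} := f @: finset.setT :|: h @: finset.setT.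
have cardP : (#|P| <= 2 * t)%N.
  rewrite mul2n -addnn; apply: leq_trans (leq_card_setU _ _) _.
  by rewrite !card_imset // cardsT card_ord.
have [/exists_inP[w wS /andP[wP /existsP[i iw]]]|now] :=
  boolP [exists (w | w \in S), (w \notin P) &&
    [exists i, 2 < multiplicity E1 E2 (f i) w + multiplicity E1 E2 (h i) w]%N].
  exists f, h, w, i; split=> //.
  - by move=> i' j; have := fhG i' j => /andP[].
  - split=> j; apply: contraNneq wP => <-; rewrite inE imset_f ?inE ?orbT //.
exfalso.
(* Without an apex, a vertex outside the biclique contributes at most 2 per index, and one of the at
   most [2 * t] biclique vertices at most 4. By [ds] the total stays below the
   [t * (2 * (1 + d) * s)] forced by the degrees. *)
have ub v : v \in S -> (\sum_(i < t) (multiplicity E1 E2 (f i) v +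
    multiplicity E1 E2 (h i) v) <= t * (2 + 2 * (v \in P)))%N.
  move=> vS; rewrite -[X in (_ <= X * _)%N](card_ord t) -sum_nat_const.
  apply: leq_sum => i _; case: (boolP (v \in P)) => vP /=.
    exact: leq_add (multiplicity_le2 _ _ _ _) (multiplicity_le2 _ _ _ _).
  move: now; rewrite negb_exists_in => /forall_inP /(_ v vS).
  by rewrite vP /= negb_exists => /forallP /(_ i); rewrite -leqNgt.
have {}ub : (\sum_(i < t) \sum_(v in S) (multiplicity E1 E2 (f i) v +
    multiplicity E1 E2 (h i) v) <= \sum_(v in S) t * (2 + 2 * (v \in P)))%N.
  by rewrite exchange_big; apply: leq_sum.
have : (\sum_(v in S) t * (2 + 2 * (v \in P)) <= t * (2 * #|S| + 2 * (2 * t)))%N.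
  rewrite -big_distrr /= leq_mul2l big_split /= -big_distrr /= sum_nat_const.
  rewrite (mulnC #|S|) leq_add2l leq_mul2l /= (leq_trans _ cardP) ?orbT //.
  rewrite -sum1_card [leqRHS]big_mkcond /= [leqRHS](bigID (mem S)) /=.
  by apply: leq_trans (leq_addr _ _); apply: leq_sum => v _; case: (v \in P).
move/(leq_trans ub); rewrite leqNgt => /negP; apply.
rewrite -(ltr_nat R) natr_sum; apply: lt_le_trans (_ : t%:R * (2 * (1 + d) * s) <= _).
  rewrite natrM ltr_pM2l ?ltr0n // natrD !natrM -/s.
  have := ler0n R t; lra.
rewrite -[X in X%:R * _]card_ord mulr_natl -sumr_const ler_sum // => i _.
by rewrite big_split natrD; have := degS _ (fS i); have := degS _ (hS i); lra.
Qed.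

(** [E] gives the colour class demanded at each position. Since both classes are demanded somewhere,
    an edge known to have only one colour can still be placed in an odd cycle. *)
Lemma cycle_in_dense_pair (R : realType) (eps : R) (k : nat) :
  0 < eps -> eps <= 1 -> (3 <= k)%N ->
  exists N : nat, forall (V : finType) (E1 E2 : {set {set V}})
      (E : 'I_k -> {set {set V}}),
    simple_graph E1 -> simple_graph E2 -> (N <= #|V|)%N ->
    (1 + eps) * 'C(#|V|, 2)%:R <= #|E1|%:R + #|E2|%:R ->
    (forall x, E x = E1 \/ E x = E2) ->
    (exists j, E j = E1) -> (exists j, E j = E2) ->
    exists phi : 'I_k -> V,
      injective phi /\ forall x, [set phi x; phi (ordS x)] \in E x.
Proof.
move=> e0 e1 k3; have [k_odd|k_even] := boolP (odd k); last first.
  have [|N HN] := @biclique_with_apex R eps k e0 e1; first by lia.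
  exists N => V E1 E2 E sE1 sE2 NV dens E12 _ _.
  have [f [h [w [i [[f_inj h_inj] fhE _ _]]]]] := HN V E1 E2 sE1 sE2 NV dens.
  apply: (@even_cycle_in_biclique k V E f h) => //; first by lia.
    move=> i' j; apply/eqP => fh; have [] := fhE i' j.
    by rewrite fh loop_notin.
  by move=> x i' j; have [] := fhE i' j; case: (E12 x) => ->.
have [m km] : exists m, k = m.*2.+3.
  by exists (k./2.-1); have := odd_double_half k; rewrite k_odd; lia.
subst k => {k3 k_odd}.
have [|N HN] := @biclique_with_apex R eps m.+1 e0 e1; first by [].
exists N => V E1 E2 E sE1 sE2 NV dens E12 hasE1 hasE2.
have [f [h [w [i [[f_inj h_inj] fhE [fw hw] apex]]]]] := HN V E1 E2 sE1 sE2 NV dens.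
have fh i' j : f i' != h j.
  by apply/eqP => fh; have [] := fhE i' j; rewrite fh loop_notin.
(* Either side may carry the doubly coloured edge to [w], so the argument is stated for sides [p]
   and [q] and used in both orders. *)
have close (p q : 'I_m.+1 -> V) : injective p -> injective q ->
    (forall i j, p i != q j) -> (forall i, p i != w) -> (forall i, q i != w) ->
    (forall i j, [set p i; q j] \in E1 /\ [set p i; q j] \in E2) ->
    multiplicity E1 E2 (p i) w = 2 -> (0 < multiplicity E1 E2 (q i) w)%N ->
    exists phi : 'I_(m.*2.+3) -> V,
      injective phi /\ forall x, [set phi x; phi (ordS x)] \in E x.
  move=> p_inj q_inj pq pw qw pqE p2 q1.
  have [pE1 pE2] : [set w; p i] \in E1 /\ [set w; p i] \in E2.
    by move: p2; rewrite /multiplicity finset.setUC; do 2!case: (_ \in _).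
  have [j qEj] : exists j, [set q i; w] \in E j.
    move: q1; rewrite /multiplicity addn_gt0 !lt0b => /orP[] qE.
      by have [j Ej] := hasE1; exists j; rewrite Ej.
    by have [j Ej] := hasE2; exists j; rewrite Ej.
  apply: (@odd_cycle_in_biclique m V E p q w i j) => //.
    by move=> x i' j'; have [] := pqE i' j'; case: (E12 x) => ->.
  by move=> x; case: (E12 x) => ->.
have [f2|f2] := eqVneq (multiplicity E1 E2 (f i) w) 2.
  by apply: (close f h) => //; move: apex; rewrite f2.
have := multiplicity_le2 E1 E2 (f i) w; have := multiplicity_le2 E1 E2 (h i) w.
move: f2 apex => /eqP f2 apex h_le f_le.
apply: (close h f) => //; [by move=> ? ?; rewrite eq_sym| |lia|lia].
by move=> i' j; rewrite finset.setUC.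
Qed.

Lemma colored_cycle_copy (k : nat) (k3 : (3 <= k)%N) (c : {set 'I_k} -> bool)
    (V : finType) (E1 E2 : {set {set V}}) (phi : 'I_k -> V) :
  injective phi ->
  (forall x, [set phi x; phi (ordS x)] \in if c [set x; ordS x] then E1 else E2) ->
  contains_copy (colored_cycle k3 c) E1 E2.
Proof.
move=> phi_inj phiE; apply/existsP; exists [ffun x => phi x]; apply/andP; split.
  by apply/injectiveP => x y; rewrite !ffunE => /phi_inj.
apply/forallP => x; apply/forallP => y; apply/implyP => /imsetP[/= i _ xy].
have {xy} : [set phi x; phi y] = [set phi i; phi (ordS i)] /\ [set x; y] = [set i; ordS i].
  split=> //; have := congr1 (fun A : {set 'I_k} => phi @: A) xy.
  by rewrite !imsetU1 !imset_set1.
by rewrite !ffunE => -[-> ->]; have := phiE i; case: ifP.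
Qed.

(** Otherwise both classes exceed [(1 / 2 + eps) * 'C(n, 2)], so their sum, or twice either one, is
    large enough for [cycle_in_dense_pair]. *)
Lemma achievable_cycle_le (R : realType) (eps : R) (k : nat) (k3 : (3 <= k)%N)
    (c : {set 'I_k} -> bool) :
  0 < eps -> eps <= 1 ->
  exists N : nat, forall n T, (N <= n)%N ->
    achievable n (colored_cycle k3 c) T -> T%:R <= (1 / 2 + eps) * 'C(n, 2)%:R :> R.
Proof.
move=> e0 e1; have [N HN] := cycle_in_dense_pair e0 e1 k3.
exists N => n T Nn /existsP[E1 /existsP[E2 /and5P[sE1 sE2 TE1 TE2 /negP noC]]].
rewrite leNgt; apply/negP => large; apply: noC.
rewrite -(ler_nat R) in TE1; rewrite -(ler_nat R) in TE2.
have C0 : 0 <= eps * 'C(n, 2)%:R by rewrite mulr_ge0 ?ler0n ?ltW.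
pose E x := if c [set x; ordS x] then E1 else E2.
have Nn' : (N <= #|'I_n|)%N by rewrite card_ord.
pose x0 : 'I_k := Ordinal (leq_trans (isT : 0 < 3)%N k3).
have E12 x : E x = E1 \/ E x = E2 by rewrite /E; case: ifP; [left|right].
suff [phi [phi_inj phiE]] : exists phi : 'I_k -> 'I_n,
    injective phi /\ forall x, [set phi x; phi (ordS x)] \in E x.
  exact: colored_cycle_copy phi_inj phiE.
(* A colour that the cycle does not use is replaced by the other one. *)
have [/existsP[j jE1]|no1] := boolP [exists j, E j == E1]; last first.
  have EE2 x : E x = E2.
    by case: (E12 x) => // xE; case/negP: no1; apply/existsP; exists x; apply/eqP.
  apply: (HN _ E2 E2) => //; [|by move=> x; left|by exists x0|by exists x0].
  by rewrite card_ord; lra.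
have [/existsP[j' j'E2]|no2] := boolP [exists j, E j == E2]; last first.
  have EE1 x : E x = E1.
    by case: (E12 x) => // xE; case/negP: no2; apply/existsP; exists x; apply/eqP.
  apply: (HN _ E1 E1) => //; [|by move=> x; left|by exists x0|by exists x0].
  by rewrite card_ord; lra.
apply: (HN _ E1 E2) => //; last 2 first.
- by exists j; apply/eqP.
- by exists j'; apply/eqP.
by rewrite card_ord; lra.
Qed.

(** * Sampling *)

(** Each late term, increased by [eps], eventually bounds the sequence, so the upper limit is at
    most the lower limit. *)
Lemma cvgn_almost_nonincreasing (R : realType) (u : nat -> R) :
  (forall n, 0 <= u n <= 1) ->
  (forall eps : R, 0 < eps -> exists M, forall m, (M <= m)%N ->
    exists N, forall n, (N <= n)%N -> u n <= u m + eps) ->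
  cvgn u.
Proof.
move=> u01 u_dec.
(* The infimum of the eventual upper bounds is the upper limit of [u]. *)
pose S : set R := [set x : R | exists N, forall n, (N <= n)%N -> u n <= x]%classic.
have hS : has_inf S.
  split; first by exists 1, 0%N => n _; have /andP[] := u01 n.
  by exists 0 => x [N /(_ N (leqnn N))]; apply: le_trans; have /andP[] := u01 N.
apply/cvg_ex; exists (inf S); apply/cvgrPdist_le => eps e0.
have [x [N xN] xinf] := inf_adherent e0 hS.
have [M uM] := u_dec eps e0.
exists (maxn N M) => // n /=; rewrite geq_max => /andP[Nn Mn].
have [N' uN'] := uM n Mn.
have : inf S <= u n + eps by apply: ge_inf; [exact: hS.2|exists N'].
by have := xN n Nn; rewrite ler_norml; lra.
Qed.

(** Each pair of positions is counted once, with the newer vertex as second argument of [r]. *)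
Fixpoint pair_sum (R : realFieldType) (V : finType) (r : V -> V -> R) (s : seq V) : R :=
  if s is v :: s' then pair_sum r s' + \sum_(u <- s') r u v else 0.

Definition kernel_mean (R : realFieldType) (V : finType) (r : V -> V -> R) (u : V) : R :=
  (\sum_v r u v) / #|V|%:R.

(** For uniform [v], the mean increment of [pair_sum] is the sum of the kernel means, so its square
    must be controlled too. The weight [2 * (size s) ^ 2] balances the two terms: the growth rate
    becomes about [5 / (2 * m)], below the rate [3 / m] of a cubic bound. *)
Definition potential (R : realFieldType) (V : finType) (r : V -> V -> R) (s : seq V) : R :=
  pair_sum r s ^+ 2 + 2 * (size s)%:R ^+ 2 * (\sum_(u <- s) kernel_mean r u) ^+ 2.

Lemma potential_ge0 (R : realFieldType) (V : finType) (r : V -> V -> R) (s : seq V) :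
  0 <= potential r s.
Proof.
rewrite /potential; apply: addr_ge0; first exact: sqr_ge0.
by apply: mulr_ge0; [rewrite mulr_ge0|exact: sqr_ge0].
Qed.

Lemma kernel_mean_norm (R : realFieldType) (V : finType) (r : V -> V -> R) (u : V) :
  (forall u v, `|r u v| <= 1) -> `|kernel_mean r u| <= 1.
Proof.
move=> r1; rewrite normrM normfV normr_nat.
have [V0|V0] := posnP #|V|; first by rewrite V0 invr0 mulr0.
rewrite ler_pdivrMr ?ltr0n // mul1r; apply: le_trans (ler_norm_sum _ _ _) _.
by rewrite -sumr_const ler_sum.
Qed.

Lemma potential_step (R : realFieldType) (V : finType) (r : V -> V -> R) (s : seq V) (m : R) :
  (forall u v, `|r u v| <= 1) -> \sum_u \sum_v r u v = 0 ->
  (size s)%:R = m -> 0 < m ->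
  m ^+ 2 * \sum_v potential r (v :: s) <=
    #|V|%:R * ((m ^+ 2 + 5 / 2 * m + 1) * potential r s +
              m ^+ 2 * (3 * m ^+ 2 + 4 * m + 2)).
Proof.
move=> r1 r0 sm m0; rewrite /potential /= sm.
have [V0|V0] := posnP #|V|.
  rewrite big_pred0 ?V0 ?mul0r ?mulr0 // => v.
  by have := card0_eq V0 v; rewrite inE.
set a := pair_sum r s; set L := \sum_(u <- s) kernel_mean r u.
set n : R := #|V|%:R.
have n0 : 0 < n by rewrite ltr0n.
pose X v := \sum_(u <- s) r u v.
have X1 v : X v ^+ 2 <= m ^+ 2.
  rewrite -[X v ^+ 2]real_normK ?num_real // lerXn2r ?nnegrE ?(ltW m0) //.
  apply: le_trans (ler_norm_sum _ _ _) _; have <- : \sum_(u <- s) 1 = m.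
    by rewrite big_const_seq count_predT iter_addr_0.
  by rewrite ler_sum.
have sumX : \sum_v X v = n * L.
  rewrite exchange_big mulr_sumr; apply: eq_bigr => u _.
  by rewrite /kernel_mean mulrCA divff ?mulr1 // gt_eqF.
have sumrho : \sum_v kernel_mean r v = 0 by rewrite -mulr_suml r0 mul0r.
have sumrho2 : \sum_v kernel_mean r v ^+ 2 <= n.
  rewrite -[leRHS]mulr1 mulr_natl -sumr_const ler_sum // => v _.
  by rewrite -[_ ^+ 2]real_normK ?num_real // exprn_ile1 ?kernel_mean_norm.
have sumX2 : \sum_v X v ^+ 2 <= n * m ^+ 2.
  by rewrite mulr_natl -sumr_const ler_sum.
have -> : \sum_v ((a + \sum_(u <- s) r u v) ^+ 2 +
      2 * (size s).+1%:R ^+ 2 * (\sum_(u <- v :: s) kernel_mean r u) ^+ 2) =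
    n * a ^+ 2 + 2 * a * (n * L) + \sum_v X v ^+ 2 +
    2 * (m + 1) ^+ 2 * (n * L ^+ 2 + \sum_v kernel_mean r v ^+ 2).
  rewrite -[(size s).+1%:R]natr1 sm big_split /= -mulr_sumr; congr (_ + _ * _).
    under eq_bigr do rewrite sqrrD -/(X _).
    rewrite !big_split /= sumr_const -mulr_sumr sumX /n; congr (_ + _ + _).
      by rewrite mulr_natl.
    by ring.
  rewrite (eq_bigr (fun v => (L + kernel_mean r v) ^+ 2)); last first.
    by move=> v _; rewrite big_cons addrC.
  under eq_bigr do rewrite sqrrD.
  rewrite !big_split /= sumr_const -mulr_sumr sumrho !mulr0 !addr0 mulr_natl.
  by [].
(* This square bounds the cross term: [2 * a * L <= (a ^ 2 + m ^ 2 * L ^ 2) / m]. *)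
have am : 0 <= n * (m * (a - m * L) ^+ 2).
  by rewrite mulr_ge0 ?(ltW n0) // mulr_ge0 ?sqr_ge0 // ltW.
have na : 0 <= n * (m * a ^+ 2) by rewrite mulr_ge0 ?(ltW n0) // mulr_ge0 ?sqr_ge0 // ltW.
have na2 : 0 <= n * a ^+ 2 by rewrite mulr_ge0 ?(ltW n0) ?sqr_ge0.
have h1 := ler_wpM2l (sqr_ge0 m) sumX2.
have c0 : 0 <= m ^+ 2 * (2 * (m + 1) ^+ 2).
  by apply: mulr_ge0; [exact: sqr_ge0|apply: mulr_ge0 => //; exact: sqr_ge0].
have h2 := ler_wpM2l c0 sumrho2.
lra.
Qed.

(** For a sample of size [x], the mean of the next total potential falls short of [24 * (x + 1) ^ 3]
    by at least [6 * x ^ 2 + 40 * x + 20]. With [#|V| >= 4 * (x + 1) ^ 2] this margin pays for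
    excluding the [x] vertices already chosen. *)
Lemma greedy_sample (R : realFieldType) (V : finType) (r1 r2 : V -> V -> R) (m : nat) :
  (forall u v, `|r1 u v| <= 1) -> \sum_u \sum_v r1 u v = 0 ->
  (forall u v, `|r2 u v| <= 1) -> \sum_u \sum_v r2 u v = 0 ->
  (4 * m.+1 ^ 2 <= #|V|)%N ->
  exists s : seq V, [/\ uniq s, size s = m.+1 &
    potential r1 s + potential r2 s <= 24 * m.+1%:R ^+ 3].
Proof.
move=> r1_1 r1_0 r2_1 r2_0; elim: m => [|m IH] mV.
  have /card_gt0P[v _] : (0 < #|V|)%N by apply: leq_trans mV.
  exists [:: v]; split=> //; rewrite /potential /= !big_nil !big_seq1.
  have rho (r : V -> V -> R) : (forall u v, `|r u v| <= 1) -> kernel_mean r v ^+ 2 <= 1.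
    move=> r_1; rewrite -[_ ^+ 2]real_normK ?num_real //.
    by rewrite exprn_ile1 ?kernel_mean_norm.
  by have := rho r1 r1_1; have := rho r2 r2_1; lra.
have [|s [s_uniq s_size s_pot]] := IH.
  by apply: leq_trans mV; rewrite leq_mul2l leq_sqr leqnSn.
pose P v := potential r1 (v :: s) + potential r2 (v :: s).
have P0 v : 0 <= P v by rewrite addr_ge0 ?potential_ge0.
have [/existsP[v /andP[vs Pv]]|none] :=
    boolP [exists v, (v \notin s) && (P v <= 24 * m.+2%:R ^+ 3)].
  by exists (v :: s); rewrite /= vs s_uniq s_size.
exfalso.
set x : R := m.+1%:R in s_pot.
have x1 : 1 <= x by rewrite ler1n.
have step1 := @potential_step R V r1 s x r1_1 r1_0 (congr1 _ s_size) (lt_le_trans ltr01 x1).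
have step2 := @potential_step R V r2 s x r2_1 r2_0 (congr1 _ s_size) (lt_le_trans ltr01 x1).
set n : R := #|V|%:R in step1 step2.
have nx : 4 * (x + 1) ^+ 2 <= n.
  by move: mV; rewrite -(ler_nat R) natrM natrX -[m.+2%:R]natr1.
have n0 : 0 < n by apply: lt_le_trans nx; rewrite mulr_gt0 // exprn_gt0 //; lra.
have sumP : \sum_v P v <= n * (24 * x ^+ 3 + 66 * x ^+ 2 + 32 * x + 4).
  have x2 : 0 < x ^+ 2 by rewrite exprn_gt0 //; lra.
  rewrite -(ler_pM2l x2) big_split mulrDr.
  have c0 : 0 <= n * (x ^+ 2 + 5 / 2 * x + 1).
    by rewrite mulr_ge0 ?(ltW n0) //; nra.
  have := ler_wpM2l c0 s_pot.
  lra.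
have cardNs : #|[set v | v \notin s]|%:R = n - x.
  have := cardsC [set v in s]; rewrite cardsE (card_uniqP s_uniq) s_size => nE.
  rewrite /n -nE natrD -/x addrAC subrr add0r; congr (_%:R); apply: eq_card => v.
  by rewrite !inE.
have : (n - x) * (24 * (x + 1) ^+ 3) <= \sum_v P v.
  rewrite -cardNs mulr_natl -sumr_const.
  rewrite [leRHS](bigID (fun v => v \notin s)) /= -[leLHS]addr0.
  apply: lerD; last by apply: sumr_ge0.
  rewrite big_set; apply: ler_sum => v vs; apply/ltW; rewrite ltNge.
  apply/negP => Pv; case/negP: none; apply/existsP; exists v.
  have {}vs : v \notin s := vs.
  by rewrite vs -[m.+2%:R]natr1.
have c0 : 0 <= 6 * x ^+ 2 + 40 * x + 20 by nra.
have := ler_wpM2r c0 nx.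
have y0 : 0 < (x + 1) ^+ 2 * (34 * x + 20) by rewrite mulr_gt0 ?exprn_gt0 //; lra.
lra.
Qed.

(** * Graphs induced on a sample *)

Definition pullback (W V : finType) (phi : W -> V) (E : {set {set V}}) :
  {set {set W}} := [set e : {set W} | phi @: e \in E].

Lemma pullback_edge (W V : finType) (phi : W -> V) (E : {set {set V}}) (x y : W) :
  ([set x; y] \in pullback phi E) = ([set phi x; phi y] \in E).
Proof. by rewrite inE imsetU1 imset_set1. Qed.

Lemma pullback_simple (W V : finType) (phi : W -> V) (E : {set {set V}}) :
  injective phi -> simple_graph E -> simple_graph (pullback phi E).
Proof.
move=> phi_inj /forall_inP sE; apply/forall_inP => e.
by rewrite inE => /sE; rewrite card_imset.
Qed.

Lemma pullback_copy (H : colored_graph) (W V : finType) (phi : W -> V)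
    (E1 E2 : {set {set V}}) :
  injective phi -> contains_copy H (pullback phi E1) (pullback phi E2) ->
  contains_copy H E1 E2.
Proof.
move=> phi_inj /existsP[f /andP[/injectiveP f_inj /forallP fE]].
apply/existsP; exists [ffun x => phi (f x)]; apply/andP; split.
  by apply/injectiveP => x y; rewrite !ffunE => /phi_inj /f_inj.
apply/forallP => x; apply/forallP => y.
by have /forallP /(_ y) := fE x; rewrite !pullback_edge !ffunE.
Qed.

Lemma pair_sum_sub_cst (R : realFieldType) (V : finType) (r : V -> V -> R)
    (p : R) (s : seq V) :
  pair_sum (fun u v => r u v - p) s = pair_sum r s - p * 'C(size s, 2)%:R.
Proof.
elim: s => [|v s IH] /=; first by rewrite bin0n mulr0 subr0.
rewrite IH sumrB big_const_seq count_predT iter_addr_0 binS bin1 natrD.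
by rewrite -mulr_natr; ring.
Qed.

Lemma pair_sum_sym (R : realFieldType) (V : finType) (r : V -> V -> R) (s : seq V) :
  (forall u v, r u v = r v u) -> (forall v, r v v = 0) ->
  \sum_(u <- s) \sum_(v <- s) r u v = 2 * pair_sum r s.
Proof.
move=> rC r0; elim: s => [|v s IH] /=; first by rewrite big_nil mulr0.
rewrite !big_cons r0 add0r mulrDr -IH.
rewrite [X in _ + X = _](eq_bigr (fun u => r u v + \sum_(w <- s) r u w)); last first.
  by move=> u _; rewrite big_cons.
rewrite big_split /= (eq_bigr (r^~ v)) //.
by ring.
Qed.

Lemma potential_adj (R : realFieldType) (V : finType) (E : {set {set V}}) (p : R)
    (s : seq V) : simple_graph E -> uniq s ->
  (#|pullback (tnth (in_tuple s)) E|%:R - p * 'C(size s, 2)%:R) ^+ 2 <=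
    potential (fun u v => ([set u; v] \in E)%:R - p) s.
Proof.
move=> sE s_uniq; rewrite /potential pair_sum_sub_cst.
pose r u v : R := ([set u; v] \in E)%:R.
have <- : #|pullback (tnth (in_tuple s)) E|%:R = pair_sum r s.
  apply: (@mulfI _ 2); first by rewrite pnatr_eq0.
  rewrite -pair_sum_sym /r; last 2 first.
  - by move=> u v; rewrite finset.setUC.
  - by move=> v; rewrite loop_notin.
  rewrite -natrM -sum_adj; last first.
    by apply: pullback_simple => //; apply/tuple_uniqP.
  rewrite natr_sum [RHS]big_tnth; apply: eq_bigr => i _.
  by rewrite natr_sum [RHS]big_tnth; apply: eq_bigr => j _; rewrite pullback_edge.
rewrite lerDl; apply: mulr_ge0; last exact: sqr_ge0.
by rewrite mulr_ge0.
Qed.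

Lemma sample_pair (R : realFieldType) (V : finType) (E1 E2 : {set {set V}}) (m : nat) :
  simple_graph E1 -> simple_graph E2 -> (0 < m)%N -> (4 * m ^ 2 <= #|V|)%N ->
  exists phi : 'I_m -> V, injective phi /\
    forall E, E = E1 \/ E = E2 ->
      (#|pullback phi E|%:R - 2 * #|E|%:R / #|V|%:R ^+ 2 * 'C(m, 2)%:R) ^+ 2
        <= 24 * m%:R ^+ 3 :> R.
Proof.
case: m => // m sE1 sE2 _ mV.
have V0 : 0 < #|V|%:R :> R by rewrite ltr0n; apply: leq_trans mV.
(* Dividing by [#|V| ^ 2], not by [#|V| * (#|V| - 1)], makes the centred kernel sum to zero with its
   diagonal entries [- p E] included. *)
pose p (E : {set {set V}}) : R := 2 * #|E|%:R / #|V|%:R ^+ 2.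
have sum_r E : simple_graph E ->
    \sum_(u : V) \sum_(v : V) (([set u; v] \in E)%:R - p E) = 0.
  move=> sE; under eq_bigr do rewrite sumrB.
  rewrite sumrB !sumr_const.
  have -> : \sum_(u : V) \sum_(v : V) ([set u; v] \in E)%:R = 2 * #|E|%:R :> R.
    rewrite -natrM -sum_adj // natr_sum; apply: eq_bigr => u _.
    by rewrite natr_sum.
  rewrite -mulrnA -[X in _ - X]mulr_natr natrM /p; field.
  by rewrite gt_eqF.
have p01 E : simple_graph E -> 0 <= p E <= 1.
  move=> sE; rewrite divr_ge0 ?mulr_ge0 ?exprn_ge0 ?ler0n //=.
  rewrite ler_pdivrMr ?exprn_gt0 // mul1r -natrM -sum_adj // -natrX ler_nat.
  apply: (@leq_trans (\sum_(u : V) \sum_(v : V) 1)%N).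
    by do 2!(apply: leq_sum => ? _); case: (_ \in _).
  by rewrite !sum_nat_const muln1 mulnn.
have r1 E : simple_graph E -> forall u v, `|([set u; v] \in E)%:R - p E| <= 1.
  move=> sE u v; have /andP[] := p01 E sE.
  by case: (_ \in E) => /=; rewrite ler_norml; lra.
have [s [s_uniq s_size s_pot]] := greedy_sample (r1 E1 sE1) (sum_r E1 sE1)
  (r1 E2 sE2) (sum_r E2 sE2) mV.
have pot_le E : E = E1 \/ E = E2 ->
    potential (fun u v => ([set u; v] \in E)%:R - p E) s <= 24 * m.+1%:R ^+ 3.
  move=> E12; apply: le_trans s_pot.
  by case: E12 => ->; rewrite ?lerDl ?lerDr potential_ge0.
rewrite -s_size in pot_le *.
exists (tnth (in_tuple s)); split; first exact/tuple_uniqP.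
move=> E E12; apply: le_trans (pot_le E E12).
by apply: potential_adj => //; case: E12 => ->.
Qed.

(** * Convergence of the density *)

Lemma mex2n_achievable (n : nat) (H : colored_graph) :
  mex2n n H = 0%N \/ achievable n H (mex2n n H).
Proof.
rewrite /mex2n; elim/big_ind: _ => [|x y|i]; [by left| |by right].
by rewrite /maxn; case: ifP.
Qed.

Lemma mex2n_le (n : nat) (H : colored_graph) : (mex2n n H <= 'C(n, 2))%N.
Proof. by apply/bigmax_leqP => T _; rewrite -ltnS. Qed.

Lemma le_mex2n (n : nat) (H : colored_graph) (T : nat) :
  (T <= 'C(n, 2))%N -> achievable n H T -> (T <= mex2n n H)%N.
Proof.
rewrite -ltnS => TC aT.
exact: (@leq_bigmax_cond _ (fun T : 'I_('C(n, 2)).+1 => achievable n H T)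
  (fun T => T) (Ordinal TC)).
Qed.

Lemma card_simple_graph_le (n : nat) (E : {set {set 'I_n}}) :
  simple_graph E -> (#|E| <= 'C(n, 2))%N.
Proof.
move=> /forall_inP sE; rewrite -[n in 'C(n, _)]card_ord -card_draws.
by apply: subset_leq_card; apply/fintype.subsetP => e /sE; rewrite inE.
Qed.

Lemma mex2_density_bound (R : realType) (H : colored_graph) (n : nat) :
  0 <= mex2_density R H n <= 1.
Proof.
rewrite /mex2_density divr_ge0 ?ler0n //=.
have [->|C0] := posnP 'C(n, 2); first by rewrite invr0 mulr0.
by rewrite ler_pdivrMr ?ltr0n // mul1r ler_nat mex2n_le.
Qed.

(** Sample [m] vertices from an optimal pair on [n] vertices: the induced pair still avoids [H]. One
    [eps] pays for the sampling deviation, the other for normalising by [n ^ 2 / 2] in place of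
    ['C(n, 2)]. *)
Lemma mex2_density_sample (R : realType) (H : colored_graph) (eps : R) (m n : nat) :
  0 < eps -> (1 < m)%N -> (4 * m ^ 2 <= n)%N -> 1 / eps <= n%:R ->
  24 * m%:R ^+ 3 <= (eps * 'C(m, 2)%:R) ^+ 2 ->
  mex2_density R H n <= mex2_density R H m + 2 * eps.
Proof.
move=> e0 m1 mn en me.
have m0 := ltnW m1.
have := mex2_density_bound R H m; have := mex2_density_bound R H n.
rewrite /mex2_density => /andP[dn0 dn1] /andP[dm0 _].
case: (mex2n_achievable n H) => [->|].
  by rewrite mul0r addr_ge0 ?mulr_ge0 // ltW.
move=> /existsP[E1 /existsP[E2 /and5P[sE1 sE2 TE1 TE2 noH]]].
have [|phi [phi_inj phiE]] := @sample_pair R 'I_n E1 E2 m sE1 sE2 m0.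
  by rewrite card_ord.
have Cm : 0 < 'C(m, 2)%:R :> R by rewrite ltr0n bin_gt0.
have n0 : 0 < n%:R :> R by apply: lt_le_trans en; rewrite divr_gt0.
have n1 : 1 < n%:R :> R.
  rewrite ltr1n; apply: leq_trans mn; apply: (leq_trans m1).
  by rewrite -mulnn mulnA leq_pmull // muln_gt0.
have Cn : 0 < 'C(n, 2)%:R :> R by rewrite ltr0n bin_gt0 -(ltr_nat R).
have binn := natr_bin2 R n.
set D : R := (mex2n n H)%:R / 'C(n, 2)%:R in dn0 dn1 *.
have sampled E : E = E1 \/ E = E2 -> (mex2n n H <= #|E|)%N ->
    (D - 2 * eps) * 'C(m, 2)%:R <= #|pullback phi E|%:R.
  move=> E12 TE; have := phiE E E12; rewrite card_ord => /le_trans /(_ me).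
  have eC : 0 <= eps * 'C(m, 2)%:R by rewrite mulr_ge0 ?ler0n ?ltW.
  set p := 2 * _ / _.
  rewrite -[X in X <= _]real_normK ?num_real // ler_pXn2r ?nnegrE //.
  rewrite ler_norml => /andP[+ _].
  have : D - eps <= p.
    apply: (@le_trans _ _ (D - 1 / n%:R)).
      by rewrite lerD2l lerN2 ler_pdivrMr // mulrC -ler_pdivrMr.
    apply: (@le_trans _ _ (D * (n%:R - 1) / n%:R)).
      rewrite mulrBr mulr1 mulrBl mulfK ?gt_eqF // lerD2l lerN2.
      by rewrite ler_pM2r ?invr_gt0.
    have -> : D * (n%:R - 1) / n%:R = 2 * (mex2n n H)%:R / n%:R ^+ 2.
      have -> : n%:R - 1 = 2 * 'C(n, 2)%:R / n%:R :> R.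
        by rewrite binn mulrC mulKf // gt_eqF.
      by rewrite /D; field; rewrite !gt_eqF.
    by rewrite /p ler_pM2r ?invr_gt0 ?exprn_gt0 // ler_pM2l // ler_nat.
  move=> Dp; have := ler_wpM2r (ltW Cm) Dp.
  lra.
rewrite -lerBlDr ler_pdivlMr //.
have h1 := sampled E1 (or_introl erefl) TE1.
have h2 := sampled E2 (or_intror erefl) TE2.
set E1' := pullback phi E1 in h1; set E2' := pullback phi E2 in h2.
apply: (@le_trans _ _ (minn #|E1'| #|E2'|)%:R).
  by rewrite /minn; case: ifP.
rewrite ler_nat; apply: le_mex2n.
  by rewrite geq_min card_simple_graph_le ?pullback_simple.
apply/existsP; exists E1'; apply/existsP; exists E2'.
rewrite !pullback_simple // geq_minl geq_minr /=.
by apply: contra noH; exact: pullback_copy.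
Qed.

Lemma mex2_density_cvg (R : realType) (H : colored_graph) : cvgn (mex2_density R H).
Proof.
apply: cvgn_almost_nonincreasing => [n|eps e0]; first exact: mex2_density_bound.
pose d := eps / 2; have d0 : 0 < d by rewrite divr_gt0.
(* Here [384 = 24 * 16]: for [m >= 2], ['C(m, 2) >= m ^ 2 / 4], so
   [24 * m ^ 3 <= (d * 'C(m, 2)) ^ 2] follows from [384 <= m * d ^ 2]. *)
have c0 : 0 <= 384 / d ^+ 2 by rewrite divr_ge0 ?sqr_ge0.
exists (maxn 2 (Num.bound (384 / d ^+ 2))) => m; rewrite geq_max => /andP[m2 mb].
exists (maxn (4 * m ^ 2) (Num.bound (1 / d))) => n; rewrite geq_max => /andP[mn nb].
have -> : eps = 2 * d by rewrite /d; lra.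
apply: mex2_density_sample => //.
  apply: (le_trans (ltW (archi_boundP _))); last by rewrite ler_nat.
  by rewrite divr_ge0 // ltW.
have : 384 / d ^+ 2 <= m%:R.
  by apply: (le_trans (ltW (archi_boundP c0))); rewrite ler_nat.
rewrite ler_pdivrMr ?exprn_gt0 // => md.
have mr : 2 <= m%:R :> R by rewrite ler_nat.
have binm := natr_bin2 R m.
have Cm : m%:R ^+ 2 <= 4 * 'C(m, 2)%:R :> R by nra.
have Cm2 : (m%:R ^+ 2) ^+ 2 <= (4 * 'C(m, 2)%:R) ^+ 2 :> R.
  by apply: lerXn2r => //; rewrite nnegrE ?exprn_ge0 ?mulr_ge0.
have := ler_wpM2l (sqr_ge0 d) Cm2.
have m3 : 0 <= m%:R ^+ 3 :> R by rewrite exprn_ge0.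
have := ler_wpM2l m3 md.
lra.
Qed.

Theorem theorem1p2 (R : realType) (k : nat) (k_ge3 : (3 <= k)%N)
    (c : {set 'I_k} -> bool) :
  cvgn (mex2_density R (colored_cycle k_ge3 c)) /\
  mex2 R (colored_cycle k_ge3 c) <= 1 / 2.
Proof.
have cv := @mex2_density_cvg R (colored_cycle k_ge3 c); split=> //.
apply/ler_addgt0Pr => eps e0.
(* The cap at 1 meets the hypothesis [eps <= 1] of [achievable_cycle_le]. *)
pose d := Num.min eps 1.
have d0 : 0 < d by rewrite lt_min e0 ltr01.
have d1 : d <= 1 by rewrite ge_min lexx orbT.
have [N HN] := @achievable_cycle_le R d k k_ge3 c d0 d1.
apply: (@le_trans _ _ (1 / 2 + d)); last by rewrite lerD2l ge_min lexx.
apply: limr_le => //; exists N => // n /= Nn.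
rewrite /mex2_density.
have [->|C0] := posnP 'C(n, 2); first by rewrite invr0 mulr0 addr_ge0 ?ltW.
rewrite ler_pdivrMr ?ltr0n //.
case: (mex2n_achievable n (colored_cycle k_ge3 c)) => [->|].
  by rewrite mulr_ge0 // addr_ge0 // ltW.
exact: HN.
Qed.
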